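(* Let $\mathcal{K}$ be the set of all Keith numbers, and for a positive integer $x$ let $\mathcal{K}(x)=\mathcal{K}\cap[1,x]$. The estimate $$\#\mathcal{K}(x)\ll\frac{x}{\sqrt{\log x}}$$ holds for all positive integers $x\ge 2$; that is, there is an absolute constant $c>0$ such that $\#\mathcal{K}(x)\le c\,x/\sqrt{\log x}$ for all integers $x\ge 2$.
   Context: Keith numbers: let $N$ be a positive integer with decimal representation $a_1a_2\ldots a_n$ (digits read from left to right, $a_1\neq 0$). Let $K^N=(K^N_m)_{m\ge 1}$ be the sequence given by $K^N_1=a_1,\dots,K^N_n=a_n$ and $K^N_m=K^N_{m-1}+K^N_{m-2}+\cdots+K^N_{m-n}$ for all $m>n$. The number $N$ is a Keith number if $n\ge 2$ and $N=K^N_m$ for some $m\ge 1$. Here $\log$ is the natural logarithm and $\#\mathcal{A}$ denotes the cardinality of a set $\mathcal{A}$. *)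

(* Defs.v *)
From mathcomp Require Import all_boot.
From mathcomp Require Import boolp.

Set Implicit Arguments.
Unset Strict Implicit.
Unset Printing Implicit Defensive.

Local Open Scope nat_scope.

(* Digits are listed from the most significant one: the i-th item of [a]
   (counted from 0) is the digit a_(i+1), of weight 10 ^ (size a - (i + 1)). *)
Definition decimal_repr (a : seq nat) (N : nat) : Prop :=
  [/\ all (fun d => d < 10) a,
      head 0 a != 0 &
      N = \sum_(i < size a) nth 0 a i * 10 ^ (size a - i.+1)].

(* Only the terms K 1, K 2, ... matter; the value K 0 is never used, since
   m - size a >= 1 in the recurrence. *)
Definition keith_seq (a : seq nat) (K : nat -> nat) : Prop :=
  (forall m, 1 <= m <= size a -> K m = nth 0 a m.-1) /\
  (forall m, size a < m -> K m = \sum_(m - size a <= j < m) K j).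

Definition keith_number (N : nat) : Prop :=
  exists (a : seq nat) (K : nat -> nat),
    [/\ decimal_repr a N, keith_seq a K, 2 <= size a &
        exists2 m, 1 <= m & N = K m].

Definition keith_count (x : nat) : nat :=
  #|[pred N : 'I_x.+1 | (1 <= N <= x) && `[< keith_number N >]]|.

(* Main.v *)
Require Import Defs.
From mathcomp Require Import all_boot all_order all_algebra.
From mathcomp Require Import boolp reals exp.
From mathcomp Require Import zify lra.

Set Implicit Arguments.
Unset Strict Implicit.
Unset Printing Implicit Defensive.

Import Order.TTheory GRing.Theory Num.Theory.
Local Open Scope nat_scope.

(** The count reduces to the Keith numbers with exactly n digits, of which
    there are O(10 ^ n / sqrt n): these bounds grow geometrically, so their
    sum up to the length of x is governed by its last term, and the length of
    x is at least ln x / ln 10.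

    Every term K m of the sequence is a linear form in the digits, so N = K m
    is one linear equation in the digits of N. For m > n the coefficient of
    the i-th digit in K m does not decrease with i (keith_coef_mono) while its
    decimal weight strictly decreases; in N - K m all coefficients but at most
    one are therefore nonzero. By the Littlewood-Offord argument such an
    equation has O(10 ^ n / sqrt n) solutions (card_keith_coincidences):
    pairing each digit d with 9 - d, the choices inside the pairs that solve
    the equation correspond to an antichain of subsets, and Sperner's theorem
    bounds the size of the antichain by a central binomial coefficient.

    It remains to see that few indices m matter. The sequence essentially
    doubles at each step from the digit sum s = K n.+1 on: K (n + k).+1 is
    between 2 ^ k s / 2 and 2 ^ k s for all k that matter (keith_upper,
    keith_lower). Digit vectors with s < n are exponentially rare
    (card_small_digit_sum). For the others, s is known up to a factor 9 and N
    up to a factor 10, which confines k to eight values depending on n only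
    (keith_index_window). So eight equations suffice for each n
    (few_digit_vectors).

    Bounds of the form a <= b / sqrt n are written a ^ 2 * n <= b ^ 2, which
    keeps everything but the last step in the natural numbers. *)

(** * Antichains of sets and the Littlewood-Offord problem *)

(** Induction on J: if J is in F then it is the only member below J; otherwise
    every member avoids some i in J, and the bounds for the sets J :\ i add up
    to the bound for J, because |A|! (|J| - |A|)! is |J| - |A| copies of
    |A|! (|J| - 1 - |A|)!, one for each i that A avoids. *)
Lemma lym_inequality (T : finType) (F : {set {set T}}) (J : {set T}) :
  (forall A B, A \in F -> B \in F -> A \subset B -> A = B) ->
  \sum_(A in F | A \subset J) #|A|`! * (#|J| - #|A|)`! <= #|J|`!.
Proof.
move=> antiF; have [n] := ubnP #|J|; elim: n J => // n IHn J ltJn.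
have [JF|JnF] := boolP (J \in F).
  rewrite (big_pred1 J) ?subnn ?muln1 // => A /=.
  apply/andP/eqP => [[AF AJ]|-> //]; exact: antiF.
have JD1 i : i \in J -> #|J| = #|J :\ i|.+1.
  by move=> iJ; rewrite (cardsD1 i) iJ.
(* a member A of F is proper in J, so its weight splits equally among the
   elements of J outside A *)
have share A : (A \in F) && (A \subset J) ->
    #|A|`! * (#|J| - #|A|)`! =
    \sum_(i in J | i \notin A) #|A|`! * (#|J :\ i| - #|A|)`!.
  case/andP=> AF AJ; have pAJ : #|A| < #|J|.
    apply: proper_card; rewrite properEneq AJ andbT.
    by apply: contraNneq JnF => <-.
  rewrite (eq_bigr (fun=> #|A|`! * (#|J| - #|A|).-1`!)); last first.
    by move=> i /andP[/JD1-> _]; rewrite -subnS subSS.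
  rewrite sum_nat_const.
  have -> : #|[pred i | (i \in J) && (i \notin A)]| = #|J| - #|A|.
    by rewrite -(cardsDS AJ); apply: eq_card => i; rewrite !inE andbC.
  by case: (_ - _) (subn_gt0 #|A| #|J|) => [|d _]; rewrite ?pAJ // factS mulnCA.
rewrite (eq_bigr _ share) (exchange_big_dep (mem J)) /=; last first.
  by move=> A i _ /andP[].
apply: (@leq_trans (\sum_(i in J) #|J|.-1`!)); last first.
  by rewrite sum_nat_const; case: #|J| => // d; rewrite factS.
apply: leq_sum => i iJ; rewrite (JD1 i iJ) /=.
apply: leq_trans (IHn (J :\ i) _); last by rewrite -JD1.
rewrite leq_eqVlt; apply/orP; left; apply/eqP/eq_bigl => A.
by rewrite iJ subsetD1 /= -!andbA.
Qed.

Lemma leq_bin_half n k : 'C(n, k) <= 'C(n, n./2).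
Proof.
wlog le_k : k / k <= n./2.
  move=> IH; have [/IH//|lt_k] := leqP k n./2.
  have [le_kn|lt_nk] := leqP k n; last by rewrite bin_small.
  by rewrite -bin_sub //; apply: IH; lia.
rewrite -(subKn le_k); elim: (n./2 - k) (leq_subr k n./2) => [|d IHd] le_d.
  by rewrite subn0.
apply: leq_trans (IHd (ltnW le_d)); set j := n./2 - d.+1.
have -> : n./2 - d = j.+1 by lia.
rewrite -(@leq_pmul2l j.+1) // mul_bin_left leq_mul2r.
by apply/orP; right; lia.
Qed.

(** In the inequality above, the weight of a set is least at half size. *)
Lemma sperner (T : finType) (F : {set {set T}}) (J : {set T}) :
  (forall A B, A \in F -> B \in F -> A \subset B -> A = B) ->
  F \subset powerset J -> #|F| <= 'C(#|J|, #|J|./2).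
Proof.
move=> antiF /subsetP FJ; have := lym_inequality J antiF.
set j := #|J|; have jh : j./2 <= j by lia.
rewrite (eq_bigl (mem F)); last first.
  by move=> A; rewrite andb_idr // => /FJ; rewrite inE.
move=> lym.
rewrite -(@leq_pmul2r (j./2`! * (j - j./2)`!)) ?muln_gt0 ?fact_gt0 //.
rewrite bin_fact //; apply: leq_trans lym; rewrite -sum_nat_const.
apply: leq_sum => A /FJ; rewrite inE => /subset_leq_card AJ.
rewrite -(@leq_pmul2l 'C(j, #|A|)) ?bin_gt0 // bin_fact //.
by rewrite -(bin_fact jh) leq_mul2r leq_bin_half orbT.
Qed.

(** When all v i are positive, two distinct nested sets have different sums,
    so the sets with sum t form an antichain. Complementing every set on the
    indices with v i < 0 replaces v by its absolute value and t by another
    target, which reduces the general case to this one. *)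
Lemma littlewood_offord (R : realDomainType) (T : finType) (J : {set T})
    (v : T -> R) (t : R) :
  (forall i, i \in J -> v i != 0%R) ->
  #|[set A in powerset J | (\sum_(i in A) v i)%R == t]| <= 'C(#|J|, #|J|./2).
Proof.
move=> v0; set E := [set A in _ | _].
pose P := [set i in J | (v i < 0)%R].
pose tog (A : {set T}) := [set i | (i \in A) (+) (i \in P)].
have togK : involutive tog.
  by move=> A; apply/setP => i; rewrite !inE addbK.
have sum_tog (A : {set T}) : A \subset J -> (\sum_(i in tog A) `|v i| =
    \sum_(i in A) v i - \sum_(i in P) v i)%R.
  move=> /subsetP AJ; rewrite big_mkcond [X in (X - _)%R]big_mkcond.
  rewrite [X in (_ - X)%R]big_mkcond -sumrB; apply: eq_bigr => i _.
  rewrite !inE; have := AJ i; case: (i \in A) => [->//|_] /=.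
    by case: ltrP => v0i /=; rewrite ?subrr ?subr0 ?ger0_norm.
  by case: (i \in J) => //=; rewrite ?subrr //; case: ltrP => v0i;
     rewrite ?subrr // sub0r ltr0_norm.
rewrite -(card_imset _ (inv_inj togK)).
have tE (A : {set T}) : A \in [set tog B | B in E] ->
    A \subset J /\ (\sum_(i in A) `|v i| = t - \sum_(i in P) v i)%R.
  case/imsetP=> B; rewrite !inE => /andP[BJ /eqP<-] ->.
  split; last exact: sum_tog.
  apply/subsetP => i; rewrite !inE; have := subsetP BJ i.
  by case: (i \in B) => [->|_ /= /andP[]].
apply: sperner => [A B /tE[AJ sA] /tE[BJ sB] AB|]; last first.
  by apply/subsetP => A /tE[]; rewrite inE.
apply/eqP; rewrite eqEsubset AB /=; apply/subsetP => i iB.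
apply/negPn/negP => iA; have := sB; rewrite -sA (big_setID A) /=.
move/setIidPr: (AB) => ->; rewrite -[RHS]addr0 => /addrI/eqP.
rewrite (bigD1 i) ?inE ?iA // paddr_eq0 ?sumr_ge0 // normr_eq0.
by rewrite (negPf (v0 _ (subsetP BJ _ iB))).
Qed.

(** The maps that apply s on a subset A of J are bijections on the functions,
    so counting the solutions amounts to averaging, over all f, the proportion
    of sets A for which switching f on A gives a solution; each switch changes
    the sum by a nonzero amount, and the previous lemma bounds this
    proportion. *)
Lemma littlewood_offord_ffun (R : realDomainType) (T D : finType)
    (w : T -> D -> R) (s : D -> D) (J : {set T}) (t : R) :
  involutive s -> (forall i d, i \in J -> w i (s d) != w i d) ->
  #|[set f : {ffun T -> D} | (\sum_i w i (f i))%R == t]| * 2 ^ #|J|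
    <= #|D| ^ #|T| * 'C(#|J|, #|J|./2).
Proof.
move=> sK ws; set E := [set f | _].
pose flip (A : {set T}) (f : {ffun T -> D}) :=
  [ffun i => if i \in A then s (f i) else f i].
have flipK A : involutive (flip A).
  move=> f; apply/ffunP => i; rewrite !ffunE.
  by case: (i \in A) => //; rewrite sK.
have -> : #|E| * 2 ^ #|J| = \sum_f \sum_(A in powerset J) (flip A f \in E).
  rewrite exchange_big /= mulnC -card_powerset -sum_nat_const.
  apply: eq_bigr => A _; rewrite -sum1_card big_mkcond.
  rewrite (reindex_inj (inv_inj (flipK A))).
  by apply: eq_bigr => f _; case: ifP.
rewrite -card_ffun -sum_nat_const; apply: leq_sum => f _.
rewrite -big_mkcondr sum1_card.
have v0 i : i \in J -> (w i (s (f i)) - w i (f i))%R != 0%R.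
  by move=> iJ; rewrite subr_eq0 ws.
apply: leq_trans (littlewood_offord (t - \sum_i w i (f i))%R v0).
apply: subset_leq_card; apply/subsetP => A /andP[AJ]; rewrite !inE in AJ *.
rewrite AJ /= eq_sym => /eqP->.
rewrite -sumrB [X in X == _]big_mkcond; apply/eqP.
by apply: eq_bigr => i _; rewrite ffunE; case: ifP => // _; rewrite subrr.
Qed.

(** Squaring avoids square roots: this is the bound 2 ^ n / sqrt (n + 1) for
    the central binomial coefficient, in natural numbers. *)
Lemma bin_half_sqr n : 'C(n, n./2) ^ 2 * n.+1 <= 4 ^ n.
Proof.
have odd_even k : k.+1 * 'C(k.*2.+1, k) = k.*2.+1 * 'C(k.*2, k).
  by rewrite (mul_bin_down k.*2.+1 k) /=; congr (_ * _); lia.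
have even_odd k : 'C(k.+1.*2, k.+1) = 2 * 'C(k.*2.+1, k).
  apply/eqP; rewrite -(eqn_pmul2l (ltn0Sn k)) -mul_bin_diag doubleS /=.
  by apply/eqP; nia.
have even k : 'C(k.*2, k) ^ 2 * k.*2.+1 <= 4 ^ k.*2.
  elim: k => // k IHk.
  rewrite -(@leq_pmul2l (k.+1 ^ 2)) // mulnA -expnMn even_odd mulnCA odd_even.
  rewrite doubleS !expnS mulnA; move: IHk; set C := 'C(_, _); set p := 4 ^ _.
  move=> IHk; apply: (@leq_trans (p * (4 * k.*2.+1 * k.*2.+3))); last by nia.
  by move: (leq_mul IHk (leqnn (4 * k.*2.+1 * k.*2.+3))); nia.
have [k [->|->]] : exists k, n = k.*2 \/ n = k.*2.+1.
  by exists n./2; lia.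
  by rewrite doubleK.
rewrite /= uphalf_double -(@leq_pmul2l (k.+1 ^ 2)) // mulnA -expnMn odd_even.
move: (even k); rewrite (expnS 4); set C := 'C(_, _); set p := 4 ^ _ => evk.
apply: (@leq_trans (p * (k.*2.+1 * k.*2.+2))); last by nia.
by move: (leq_mul evk (leqnn (k.*2.+1 * k.*2.+2))); nia.
Qed.

(** Here j stands for the number of digits with a nonzero coefficient in a
    linear equation for n digits; one vanishing coefficient costs nothing,
    since the bound for j digits has the factor j + 1. *)
Lemma sqr_leq_digits a j n :
  a * 2 ^ j <= 10 ^ n * 'C(j, j./2) -> n <= j.+1 -> a ^ 2 * n <= 100 ^ n.
Proof.
move=> le_a le_n; have := bin_half_sqr j; set C := 'C(_, _) in le_a * => leC.
rewrite -(@leq_pmul2r (4 ^ j)) ?expn_gt0 //.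
have -> : 100 ^ n = (10 ^ n) ^ 2 by rewrite -expnM mulnC expnM.
have e4 : 4 ^ j = (2 ^ j) ^ 2 by rewrite -expnM mulnC expnM.
apply: (@leq_trans ((10 ^ n * C) ^ 2 * j.+1)); last first.
  by rewrite expnMn -mulnA leq_mul2l leC orbT.
by rewrite mulnAC {1}e4 -expnMn leq_mul // leq_sqr.
Qed.

(** * Terms of the sequence as linear forms in the digits *)

(** The recurrence refers to n earlier terms, so it is computed with fuel,
    which any value not below m provides. *)
Fixpoint keith_term (n : nat) (u : nat -> nat) (fuel m : nat) : nat :=
  if m <= n then u m else
  if fuel is f.+1 then \sum_(m - n <= j < m) keith_term n u f j else 0.

(** The contribution of the digit of index i, counted from 0, to the term of
    index m: the sequence grown from the unit vector with its 1 at position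
    i + 1. *)
Definition keith_coef (n i m : nat) := keith_term n (fun j => j == i.+1) m m.

Lemma keith_term_fuel n u f g m :
  m <= f -> m <= g -> keith_term n u f m = keith_term n u g m.
Proof.
elim: f g m => [|f IHf] [|g] m //=; rewrite ?leqn0.
- by move=> /eqP->.
- by move=> _ /eqP->.
move=> lef leg; case: ifP => // _; apply: eq_big_nat => j /andP[_ ltj].
by apply: IHf; lia.
Qed.

Lemma keith_coef_init n i m : m <= n -> keith_coef n i m = (m == i.+1).
Proof. by rewrite /keith_coef; case: m => [|m] //= ->. Qed.

Lemma keith_coef_rec n i m : n < m ->
  keith_coef n i m = \sum_(m - n <= j < m) keith_coef n i j.
Proof.
case: m => // m; rewrite /keith_coef /= ltnS => lt_n.
rewrite leqNgt ltnS lt_n /=; apply: eq_big_nat => j /andP[_ ltj].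
exact: keith_term_fuel.
Qed.

Lemma keith_linear a K m : keith_seq a K -> 1 <= m ->
  K m = \sum_(i < size a) nth 0 a i * keith_coef (size a) i m.
Proof.
case=> Kinit Krec; elim/ltn_ind: m => m IHm m0.
have [le_m|lt_m] := leqP m (size a); last first.
  rewrite Krec //; under [RHS]eq_bigr do rewrite keith_coef_rec // big_distrr.
  rewrite exchange_big; apply: eq_big_nat => j /andP[lej ltj]; apply: IHm => //.
  by lia.
have lt_m' : m.-1 < size a by lia.
rewrite Kinit ?m0 // (bigD1 (Ordinal lt_m')) //= keith_coef_init // prednK //.
rewrite eqxx muln1 big1 ?addn0 // => i ne_i.
rewrite keith_coef_init //; case: eqP => [e|_]; last by rewrite muln0.
by case/eqP: ne_i; apply: val_inj; rewrite /= e.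
Qed.

Lemma sum_keith_coef_init n i l : i < n ->
  \sum_(l <= j < n.+1) keith_coef n i j = (l <= i.+1).
Proof.
move=> lt_i.
rewrite (eq_big_nat _ _ (F2 := fun j => if pred1 i.+1 j then 1 else 0)).
  rewrite -big_mkcond sum1_count count_uniq_mem ?iota_uniq // mem_index_iota.
  by rewrite ltnS lt_i andbT.
by move=> j /andP[_ ltj]; rewrite keith_coef_init //=; case: eqP.
Qed.

(** A later digit stays longer in the window. For the induction, the window is
    cut after n: beyond n the terms compare one by one, and up to n the window
    catches the unit of index i + 1 whenever it catches the one of index i. *)
Lemma keith_coef_mono n i m : i.+1 < n -> n < m ->
  keith_coef n i m <= keith_coef n i.+1 m.
Proof.
move=> lt_i; elim/ltn_ind: m => m IHm lt_m; rewrite !keith_coef_rec //.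
have IH l : n < l ->
  \sum_(l <= j < m) keith_coef n i j <= \sum_(l <= j < m) keith_coef n i.+1 j.
  move=> lt_l; rewrite [leqLHS]big_nat_cond [leqRHS]big_nat_cond.
  by apply: leq_sum => j /andP[/andP[lej ltj] _]; apply: IHm; lia.
have [le_m|/IH//] := leqP (m - n) n.
rewrite !(@big_cat_nat _ _ _ n.+1 (m - n) m) //=; try by lia.
rewrite !sum_keith_coef_init //; try by lia.
by apply: leq_add; [lia | exact: IH].
Qed.

(** * Digit vectors whose value is the term of a given index *)

Definition keith_coincidences n m : {set {ffun 'I_n -> 'I_10}} :=
  [set f : {ffun 'I_n -> 'I_10} | \sum_(i < n) f i * 10 ^ (n - i.+1)
           == \sum_(i < n) f i * keith_coef n i m].

(** In value - K m = 0 the digit of index i has coefficient 10 ^ (n - i - 1) -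
    keith_coef n i m, strictly decreasing in i, hence zero for at most one i;
    the other digits d can be switched to 9 - d, which moves the linear form
    because d and 9 - d have different parities. *)
Lemma card_keith_coincidences n m : n < m ->
  #|keith_coincidences n m| ^ 2 * n <= 100 ^ n.
Proof.
move=> lt_nm; pose w (i : 'I_n) (d : 'I_10) : int :=
  (((10 ^ (n - i.+1))%:Z - (keith_coef n i m)%:Z) * d%:Z)%R.
pose J := [set i : 'I_n | 10 ^ (n - i.+1) != keith_coef n i m].
have nJ : n <= #|J|.+1.
  rewrite -{1}(card_ord n) -(cardsC J) -addn1 leq_add2l.
  apply/card_le1_eqP => i j; rewrite !inE !negbK => /eqP ei /eqP ej.
  apply: val_inj => /=.
  have mono k l : k < l -> l < n -> keith_coef n k m <= keith_coef n l m.
    elim: l => // l IHl; rewrite ltnS leq_eqVlt => /predU1P[->|ltk] ltl.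
      exact: keith_coef_mono.
    by apply: leq_trans (IHl ltk (ltnW ltl)) _; exact: keith_coef_mono.
  have neq (k l : 'I_n) : 10 ^ (n - k.+1) = keith_coef n k m ->
      10 ^ (n - l.+1) = keith_coef n l m -> ~~ (k < l).
    move=> ek el; apply/negP => ltkl; have := mono _ _ ltkl (ltn_ord l).
    by rewrite -ek -el leq_exp2l //; have := ltn_ord l; lia.
  by have := neq _ _ ei ej; have := neq _ _ ej ei; lia.
have sw i d : i \in J -> w i (rev_ord d) != w i d.
  rewrite inE /w => ne; apply/negP => /eqP/mulfI e.
  have /e : ((10 ^ (n - i.+1))%:Z - (keith_coef n i m)%:Z)%R != 0%R.
    by rewrite subr_eq0 eqz_nat.
  by rewrite /=; have := ltn_ord d; lia.
have := littlewood_offord_ffun 0%R (@rev_ordK 10) sw.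
rewrite !card_ord => le_w; apply: sqr_leq_digits nJ.
apply: leq_trans le_w; rewrite leq_mul2r; apply/orP; right.
apply: subset_leq_card; apply/subsetP => f; rewrite !inE => /eqP e.
under eq_bigr do rewrite /w mulrBl -!PoszM.
rewrite sumrB subr_eq0 -!(big_morph Posz PoszD (erefl (Posz 0))) eqz_nat.
apply/eqP; under eq_bigr do rewrite mulnC.
by rewrite e; apply: eq_bigr => i _; rewrite mulnC.
Qed.

(** Exponential moment: a vector of digit sum below n has weight
    2 ^ (9 n - digit sum) >= 2 ^ (8 n), while the total weight is
    (2 ^ 0 + ... + 2 ^ 9) ^ n = 1023 ^ n <= 4 ^ n * 2 ^ (8 n). *)
Lemma card_small_digit_sum n :
  #|[set f : {ffun 'I_n -> 'I_10} | \sum_i f i < n]| <= 4 ^ n.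
Proof.
set L := [set f | _]; rewrite -(@leq_pmul2r (2 ^ (8 * n))) ?expn_gt0 //.
apply: (@leq_trans (\sum_(f : {ffun 'I_n -> 'I_10}) \prod_i 2 ^ (9 - f i))).
  rewrite -sum_nat_const [leqRHS](bigID (mem L)) /=.
  apply: leq_trans (leq_addr _ _); apply: leq_sum => f; rewrite inE => ltf.
  rewrite -expn_sum leq_exp2l //.
  have : \sum_(i < n) (9 - f i) + \sum_(i < n) f i = n * 9.
    rewrite -big_split /= -[X in _ = X * _](card_ord n) -sum_nat_const.
    by apply: eq_bigr => i _; have := ltn_ord (f i); lia.
  by move: ltf; set A := \sum_(i < n) _; set B := \sum_(i < n) _; lia.
rewrite -(bigA_distr_bigA (fun (i : 'I_n) (d : 'I_10) => 2 ^ (9 - d))).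
rewrite prod_nat_const card_ord expnM -expnMn.
have [->|n0] := posnP n; first by rewrite !expn0.
by rewrite leq_exp2r // !big_ord_recr big_ord0.
Qed.

(** * Growth of the sequence *)

Section Growth.
Variables (n : nat) (K : nat -> nat).
Hypothesis Krec : forall m, n < m -> K m = \sum_(m - n <= j < m) K j.

(** The windows of two consecutive terms differ only at their ends. *)
Lemma keith_double m : 0 < n -> n < m -> K m.+1 + K (m - n) = 2 * K m.
Proof.
move=> n0 lt_nm.
have eS : K m.+1 = \sum_((m - n).+1 <= j < m) K j + K m.
  rewrite (Krec (leqW lt_nm)) subSn ?(ltnW lt_nm) // big_nat_recr //=; lia.
have em : K m = K (m - n) + \sum_((m - n).+1 <= j < m) K j.
  by rewrite {1}Krec // big_ltn //; lia.
by lia.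
Qed.

Lemma keith_nondecreasing m m' : 0 < n -> n < m <= m' -> K m <= K m'.
Proof.
move=> n0 /andP[lt_nm]; elim: m' => [|m' IHm]; first by lia.
rewrite leq_eqVlt => /predU1P[->//|]; rewrite ltnS => le_m.
apply: leq_trans (IHm le_m) _.
by rewrite [leqRHS]Krec ?big_nat_recr /= ?leq_addl //; lia.
Qed.

Lemma keith_upper k : 0 < n -> K (n + k).+1 <= 2 ^ k * K n.+1.
Proof.
move=> n0; elim: k => [|k IHk]; first by rewrite addn0 mul1n.
by rewrite addnS expnS; have := @keith_double (n + k).+1 n0; lia.
Qed.

(** By the doubling rule, K (n + k).+1 / 2 ^ k loses K k.+1 / 2 ^ k.+1 when k
    increases. While k < n the lost term is a digit, and these losses add up
    to at most 9; afterwards each loss is at most K n.+1 / 2 ^ n.+1 by the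
    upper bound. Under the hypotheses each of the two kinds of loss amounts to
    at most a quarter of K n.+1. *)
Lemma keith_lower k : 0 < n -> (forall j, 0 < j <= n -> K j <= 9) ->
  36 <= K n.+1 -> 4 * k <= 2 ^ n -> 2 ^ k * K n.+1 <= 2 * K (n + k).+1.
Proof.
move=> n0 K9 s36 k4; set s := K n.+1 in s36 *.
(* subtraction-free form of the loss estimate; the term 9 * 2 ^ n on the left
   makes the induction exact for the losses of the digits *)
have main : 2 ^ n * (2 ^ k * s) + 9 * 2 ^ n
    <= 2 ^ n * K (n + k).+1 + 2 ^ k * (k * s) + 2 ^ n * (9 * 2 ^ k).
  elim: k {k4} => [|k IHk].
    by rewrite addn0 expn0 mul0n !mul1n muln1 addn0 (mulnC 9).
  have dbl : K (n + k).+2 + K k.+1 = 2 * K (n + k).+1.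
    have lt_n : n < (n + k).+1 by lia.
    by rewrite -(keith_double n0 lt_n) subSn ?leq_addr // addKn.
  have small : 2 ^ n * K k.+1 <= 9 * 2 ^ n + 2 ^ k * s.
    have [lt_k|le_k] := ltnP k n.
      rewrite (mulnC 9); apply: leq_trans (leq_addr _ _).
      by rewrite leq_mul2l K9 ?orbT.
    rewrite -(subnKC le_k) expnD -mulnA; apply: leq_trans (leq_addl _ _).
    by rewrite leq_mul2l keith_upper ?orbT.
  rewrite addnS !expnS; move: IHk dbl small.
  set p := 2 ^ n; set q := 2 ^ k; set x := K _; set y := K _; set z := K _.
  move=> IHk dbl small; have e : p * y + p * z = 2 * (p * x) by nia.
  by nia.
rewrite -(@leq_pmul2l (2 ^ n)) ?expn_gt0 //; move: main k4.
set p := 2 ^ n; set q := 2 ^ k; set x := K _ => main k4.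
have h1 : 4 * (q * (k * s)) <= p * (q * s) by nia.
have h2 : 4 * (p * (9 * q)) <= p * (q * s) by nia.
by nia.
Qed.

End Growth.

(** K (n + k).+1 lies between 2 ^ k K n.+1 / 2 and 2 ^ k K n.+1, and K n.+1,
    the digit sum, between n and 9 n, so K (n + k).+1 has order 2 ^ k n
    whatever the digits are. The least k0 with 10 ^ n.-1 <= 2 ^ k0 * (9 * n)
    is thus a lower bound for k; eight doublings later the term exceeds 10 ^
    n, since 2 ^ 8 / (2 * 9) > 10. *)
Lemma keith_index_window n : 36 <= n -> exists k0, forall K m,
  (forall m, n < m -> K m = \sum_(m - n <= j < m) K j) ->
  (forall j, 0 < j <= n -> K j <= 9) ->
  n <= K n.+1 <= 9 * n -> 10 ^ n.-1 <= K m < 10 ^ n ->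
  n < m -> k0 <= m - n.+1 < k0 + 8.
Proof.
move=> n36; have n0 : 0 < n by lia.
have e10 : 10 ^ n = 10 * 10 ^ n.-1 by rewrite -expnS prednK.
have le16 : 10 ^ n.-1 <= 2 ^ (4 * n) * (9 * n).
  apply: leq_trans (leq_pmulr _ _); last by lia.
  apply: (@leq_trans (10 ^ n)); first by rewrite leq_exp2l ?leq_pred.
  by rewrite expnM leq_exp2r.
have exk : exists k, 10 ^ n.-1 <= 2 ^ k * (9 * n) by exists (4 * n).
case: (ex_minnP exk) => k0 le_k0 min_k0; exists k0 => K m Krec K9.
case/andP=> s_ge s_le /andP[N_ge N_lt] lt_nm.
set k := m - n.+1; have em : m = (n + k).+1 by lia.
have -> /= : k0 <= k.
  apply: min_k0; apply: leq_trans N_ge _; rewrite em.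
  by apply: leq_trans (keith_upper Krec _ n0) _; rewrite leq_mul2l s_le orbT.
rewrite ltnNge; apply/negP => le_k; move: N_lt; rewrite ltnNge => /negP; apply.
(* the minimality of k0 gives k0 <= 4 n *)
have big8 : 4 * (k0 + 8) <= 2 ^ n.
  have := min_k0 _ le16; have : 16 * n + 32 <= 2 ^ n; last by lia.
  rewrite -(subnKC n36) expnD; have := ltn_expl (n - 36) (isT : 1 < 2).
  by have : 1000 <= 2 ^ 36 by []; nia.
have low := keith_lower Krec n0 K9 (leq_trans n36 s_ge) big8.
have mono : K (n + (k0 + 8)).+1 <= K m.
  by apply: (keith_nondecreasing Krec n0); lia.
move: low mono; rewrite e10 expnD.
set p := 2 ^ k0 in le_k0 *; set N := K m; set M := K _.
set s := K _ in s_ge *; set q := 10 ^ _ in le_k0 * => low mono.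
have : p * n <= p * s by rewrite leq_mul2l s_ge orbT.
by rewrite (_ : 2 ^ 8 = 256) // in low; nia.
Qed.

(** * Counting Keith numbers with a given number of digits *)

Lemma decimal_value_lt a : all (fun d => d < 10) a ->
  \sum_(i < size a) nth 0 a i * 10 ^ (size a - i.+1) < 10 ^ size a.
Proof.
elim: a => [|d b IHb] /=; first by rewrite big_ord0.
case/andP=> d10 b10; rewrite big_ord_recl /= subSS subn0.
have := IHb b10; rewrite expnS; set S := \sum_(i < _) _.
by nia.
Qed.

Section Digits.
Variables (n : nat) (a : seq nat).
Hypothesis size_a : size a = n.

Definition digit_vector : {ffun 'I_n -> 'I_10} :=
  [ffun i : 'I_n => inord (nth 0 a i)].

Lemma digit_vectorE i : all (fun d => d < 10) a ->
  digit_vector i = nth 0 a i :> nat.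
Proof.
move=> /allP a10; rewrite ffunE inordK //; apply: a10.
by apply: mem_nth; rewrite size_a.
Qed.

Lemma decimal_repr_sum N : decimal_repr a N ->
  N = \sum_(i < n) digit_vector i * 10 ^ (n - i.+1).
Proof.
case=> a10 _ ->; rewrite size_a.
by apply: eq_bigr => i _; rewrite digit_vectorE.
Qed.

Lemma decimal_repr_bounds N : 0 < n -> decimal_repr a N ->
  10 ^ n.-1 <= N < 10 ^ n.
Proof.
move=> n0 [a10 h0 ->]; apply/andP; split.
  rewrite size_a (bigD1 (Ordinal n0)) //= nth0 subn1.
  by apply: leq_trans (leq_addr _ _); rewrite leq_pmull // lt0n.
by rewrite -size_a decimal_value_lt.
Qed.

End Digits.

(** The set F collects the vectors of small digit sum and eight sets of
    coincidences; each of these nine sets satisfies the bound with 1 in place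
    of 81 = 9 ^ 2. For n < 36 the trivial bound (10 ^ n) ^ 2 * n is good
    enough. *)
Lemma few_digit_vectors n : 2 <= n ->
  exists2 F : {set {ffun 'I_n -> 'I_10}}, #|F| ^ 2 * n <= 81 * 100 ^ n &
  forall a K m N, size a = n -> decimal_repr a N -> keith_seq a K ->
    1 <= m -> N = K m -> digit_vector n a \in F.
Proof.
move=> n2; have n0 : 0 < n by lia.
have [n36|n36] := ltnP n 36.
  exists setT => //; last by move=> *; rewrite inE.
  rewrite cardsT card_ffun !card_ord -expnM mulnC expnM mulnC expnAC.
  by rewrite mulnC leq_mul // ltnW // (ltn_trans n36).
have [k0 window] := keith_index_window n36.
pose low := [set f : {ffun 'I_n -> 'I_10} | \sum_i f i < n].
pose E j := keith_coincidences n (n + (k0 + j)).+1.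
exists (low :|: \bigcup_(j < 8) E j).
  have le_sum : #|low :|: \bigcup_(j < 8) E j| <= 4 ^ n + \sum_(j < 8) #|E j|.
    apply: leq_trans (leq_card_setU _ _) _.
    apply: leq_add; first exact: card_small_digit_sum.
    elim/big_rec2: _ => [|j x y _ IH]; first by rewrite cards0.
    by apply: leq_trans (leq_card_setU _ _) _; rewrite leq_add2l.
  pose b := maxn (4 ^ n) (\max_(j < 8) #|E j|).
  have sqrb : b ^ 2 * n <= 100 ^ n.
    rewrite /b; case: (leqP (4 ^ n)) => _.
      have [|j ->] := @bigop.eq_bigmax _ (fun j : 'I_8 => #|E j|).
        by rewrite card_ord.
      by apply: card_keith_coincidences; lia.
    apply: (@leq_trans ((4 ^ n) ^ 2 * 2 ^ n)).
      by rewrite leq_mul2l ltnW ?orbT // ltn_expl.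
    by rewrite -expnM mulnC expnM mulnC expnAC -expnMn leq_exp2r.
  apply: (@leq_trans ((9 * b) ^ 2 * n)); last first.
    by rewrite expnMn -mulnA leq_mul2l sqrb orbT.
  rewrite leq_mul2r leq_sqr; apply/orP; right; apply: leq_trans le_sum _.
  rewrite mulSn leq_add ?leq_maxl // -[X in X * b](card_ord 8) -sum_nat_const.
  apply: leq_sum => j _; apply: leq_trans (leq_maxr _ _).
  exact: (bigop.leq_bigmax (F := fun j : 'I_8 => #|E j|)).
move=> a K m N sza dec seqK m1 eN; have [a10 _ _] := dec.
have bounds := decimal_repr_bounds sza n0 dec.
have [Kinit Krec] := seqK; rewrite sza in Kinit Krec.
have K9 j : 0 < j <= n -> K j <= 9.
  move=> jn; rewrite Kinit // -ltnS; apply: (allP a10).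
  by rewrite mem_nth // sza; lia.
have eS : K n.+1 = \sum_i digit_vector n a i.
  rewrite Krec // subSnn big_add1 big_mkord; apply: eq_bigr => i _.
  by rewrite Kinit ?ltn_ord // digit_vectorE.
have lt_nm : n < m.
  rewrite ltnNge; apply/negP => le_mn.
  have := K9 m; rewrite m1 le_mn -eN => /(_ isT).
  case/andP: bounds => le_N _.
  have : 10 ^ 1 <= 10 ^ n.-1 by rewrite leq_exp2l //; lia.
  by lia.
rewrite !inE; have [//|le_s /=] := ltnP.
have := window K m Krec K9; rewrite eS le_s /= -eN => /(_ _ bounds lt_nm) win.
have {win}/andP[ge_k lt_k] : k0 <= m - n.+1 < k0 + 8.
  apply: win; rewrite mulnC -[X in X * _](card_ord n) -sum_nat_const.
  by apply: leq_sum => i _; rewrite -ltnS.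
have lt8 : m - n.+1 - k0 < 8 by lia.
apply/bigcupP; exists (Ordinal lt8) => //; rewrite /E /=.
have -> : (n + (k0 + (m - n.+1 - k0))).+1 = m by lia.
rewrite inE -(decimal_repr_sum sza dec) eN (keith_linear seqK m1) sza.
by apply/eqP/eq_bigr => i _; rewrite digit_vectorE.
Qed.

Definition keith_of_length x n : {set 'I_x.+1} :=
  [set N : 'I_x.+1 | `[< exists a K m,
    [/\ size a = n, 2 <= n, decimal_repr a N, keith_seq a K &
        1 <= m /\ nat_of_ord N = K m] >]].

Lemma card_keith_of_length x n :
  #|keith_of_length x n| ^ 2 * n <= 81 * 100 ^ n.
Proof.
have [n2|n2] := ltnP n 2.
  rewrite (_ : keith_of_length x n = set0) ?cards0 //.
  apply/setP => N; rewrite !inE; apply/asboolP => -[a [K [m [_]]]].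
  by rewrite leqNgt n2.
have [F leF inF] := few_digit_vectors n2.
apply: leq_trans leF; rewrite leq_mul2r leq_sqr; apply/orP; right.
pose value (f : {ffun 'I_n -> 'I_10}) : 'I_x.+1 :=
  inord (\sum_i f i * 10 ^ (n - i.+1)).
apply: leq_trans (leq_imset_card value _).
apply: subset_leq_card; apply/subsetP => N; rewrite inE => /asboolP.
case=> a [K [m [sza _ dec seqK [m1 eN]]]]; apply/imsetP.
exists (digit_vector n a); first exact: inF sza dec seqK m1 eN.
by rewrite /value -(decimal_repr_sum sza dec) inord_val.
Qed.

(** * Summation over the number of digits *)

(** The summands grow geometrically, so the last one dominates: in the
    induction step (S + e) ^ 2 <= 2 S ^ 2 + 2 e ^ 2 and L + 1 <= 2 L. *)
Lemma sqr_sum_geometric (d : nat -> nat) C L :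
  (forall n, d n ^ 2 * n <= C * 100 ^ n) ->
  (\sum_(1 <= n < L.+1) d n) ^ 2 * L <= 3 * C * 100 ^ L.
Proof.
move=> le_d; elim: L => [|L IHL]; first by rewrite muln0.
rewrite big_nat_recr //=; move: IHL (le_d L.+1).
rewrite (expnS 100 L) -!mulnn.
set S := \sum_(_ <= _ < _) _; set e := d _; set p := 100 ^ L.
rewrite -!(mulnA 3) !(mulnCA C 100); set D := C * p => leS le_e.
have leS2 : S * S * L.+1 <= 6 * D.
  have [L0|L0] := posnP L; first by rewrite /S L0 big_geq.
  by apply: (@leq_trans (2 * (S * S * L))); nia.
by nia.
Qed.

Lemma keith_count_sqr x : 0 < x ->
  exists L, x < 10 ^ L /\ keith_count x ^ 2 * L <= 243 * 100 * x ^ 2.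
Proof.
move=> x0; pose L := (trunc_log 10 x).+1; exists L.
have ltx : x < 10 ^ L by exact: trunc_log_ltn.
split => //; apply: (@leq_trans (3 * 81 * 100 ^ L)); last first.
  rewrite /L expnS mulnA leq_mul2l (_ : 100 = 10 ^ 2) // expnAC leq_sqr.
  by rewrite trunc_logP.
apply: leq_trans (sqr_sum_geometric L (card_keith_of_length x)).
rewrite leq_mul2r leq_sqr; apply/orP; right.
under [leqRHS]eq_bigr do rewrite -sum1_card big_mkcond.
rewrite exchange_big /= /keith_count -sum1_card big_mkcond.
apply: leq_sum => N _; case: ifP => // /andP[/andP[N0 leN]].
case/asboolP=> a [K [dec seqK a2 [m m1 eN]]].
have a0 : 0 < size a by lia.
have /andP[ge_N _] := decimal_repr_bounds erefl a0 dec.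
rewrite (bigD1_seq (size a)) ?iota_uniq //=.
  case: ifP => // /negP[]; rewrite inE; apply/asboolP.
  by exists a, K, m; split.
rewrite mem_index_iota a0 ltnS -(prednK a0) -(ltn_exp2l _ _ (isT : 1 < 10)).
by apply: leq_ltn_trans ge_N _; apply: leq_ltn_trans leN ltx.
Qed.

Local Open Scope ring_scope.

Theorem theorem2 (R : realType) :
  exists2 c : R, 0 < c &
    forall x : nat, (2 <= x)%N ->
      (keith_count x)%:R <= c * (x%:R / Num.sqrt (ln x%:R)).
Proof.
(* 468 ^ 2 >= 9 * 243 * 100, where 9 bounds ln 10 *)
exists 468 => // x x2; have x1 : 1 < x%:R :> R by rewrite ltr1n.
have [L [ltx le]] := keith_count_sqr (ltnW x2).
have ln0 := ln_gt0 x1; rewrite mulrA ler_pdivlMr ?sqrtr_gt0 //.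
rewrite -ler_sqr ?nnegrE ?mulr_ge0 ?sqrtr_ge0 //.
rewrite !exprMn sqr_sqrtr ?(ltW ln0) //.
have leln : ln x%:R <= 9 * L%:R :> R.
  apply: (@le_trans _ _ (ln ((10 : R) ^+ L))).
    by rewrite ler_ln ?posrE ?exprn_gt0 ?(lt_trans _ x1) // -natrX ler_nat ltnW.
  rewrite lnXn // mulr_natr ler_wMn2r //.
  have -> : 10 = 1 + 9 :> R by lra.
  by apply: le_ln1Dx; lra.
move: le; rewrite -(ler_nat R) !natrM => le.
apply: (@le_trans _ _ ((keith_count x)%:R ^+ 2 * (9 * L%:R))).
  by rewrite ler_wpM2l // sqr_ge0.
by have := sqr_ge0 (x%:R : R); nra.
Qed.
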